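(* Let $A\in\mathbb{R}^{n\times n}$ be symmetric with spectral interval contained in $[0,2c]$, $c>0$. Let $g\in\mathbb{R}^n$ with $\|g\|=1$, let $t\ge0$, let $y_k(t)=V_k\,t\,\varphi(-tH_k)e_1$ be the Krylov subspace approximation, obtained after $k$ Arnoldi steps, to $y(t)=t\varphi(-tA)g$, and let $r_k(t)=-Ay_k(t)+g-y_k'(t)$ be its residual. Then for $k\ge 2$ $$\|r_k(t)\|\le 4e^{-ct}\sum_{\nu=k}^{\infty}(\nu-k+2)(\nu-k+1)\,I_\nu(ct),$$ where $I_\nu$ denotes the modified Bessel function of the first kind of order $\nu$.
   Context: $\|\cdot\|$ is the vector/matrix 2-norm. $\varphi$ is the entire function $\varphi(z)=(e^z-1)/z$ for $z\ne0$, $\varphi(0)=1$, applied to matrices as a matrix function. Arnoldi process: $k$ steps of the Arnoldi process for $A$ started with $v_1=g/\|g\|$ (assumed not to break down before step $k$; for symmetric $A$ this is the Lanczos process) produce a matrix $V_{k+1}=[v_1,\dots,v_k,v_{k+1}]\in\mathbb{R}^{n\times(k+1)}$ with orthonormal columns and an upper Hessenberg matrix $\underline{H}_k\in\mathbb{R}^{(k+1)\times k}$ such that $$AV_k=V_{k+1}\underline{H}_k=V_kH_k+h_{k+1,k}v_{k+1}e_k^T,$$ where $V_k=[v_1,\dots,v_k]$, its columns span $\mathrm{span}(g,Ag,\dots,A^{k-1}g)$, $H_k=V_k^TAV_k$ consists of the first $k$ rows of $\underline{H}_k$, $h_{k+1,k}\ge 0$ is the $(k+1,k)$ entry of $\underline{H}_k$,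 and $e_1,e_k$ are the first and last standard basis vectors of $\mathbb{R}^k$ (if $h_{k+1,k}=0$ the last term is zero). *)

(* Defs.v *)
From mathcomp Require Import all_boot all_order all_algebra.
From mathcomp Require Import all_classical all_reals all_analysis.

Set Implicit Arguments.
Unset Strict Implicit.
Unset Printing Implicit Defensive.

Import Order.TTheory GRing.Theory Num.Theory.
Import numFieldNormedType.Exports.
Local Open Scope classical_set_scope.
Local Open Scope ring_scope.

Section Defs.
Variable R : realType.

(* Euclidean norm; `|v| on matrices is the max norm. *)
Definition norm2 n (v : 'cV[R]_n) : R := Num.sqrt (\sum_i v i 0 ^+ 2).

Definition phi (z : R) : R := if z == 0 then 1 else (expR z - 1) / z.

(* Matrix function of an entire function f that is real on R, given by its
   Taylor series at 0. *)
Definition mxfun (f : R -> R) k (M : 'M[R]_k) : 'M[R]_k :=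
  limn (series (fun j => (derive1n j f 0 / j`!%:R) *: M ^+ j)).

(* I_nu(x) = sum_m (x/2)^(2m+nu) / (m! (m+nu)!), for an integer order nu. *)
Definition besselI (nu : nat) (x : R) : R :=
  limn (series (fun m => (x / 2) ^+ (2 * m + nu) / (m`! * (m + nu)`!)%:R)).

(* First standard basis vector of R^k (zero if k = 0). *)
Definition e_first k : 'cV[R]_k := \col_(i < k) (i == 0 :> nat)%:R.

(* V = [V_k, v_{k+1}] and Hb = [H_k; h_{k+1,k} e_k^T] are the outcome of k steps
   of the Arnoldi process for A started with g/|g|, without breakdown before
   step k.  When h_{k+1,k} = 0 (which is forced if k = n) the process yields no
   v_{k+1}: the last column of V is then arbitrary, and V *m Hb = V_k H_k.
   The last two fields follow from the others. *)
Record arnoldi n k (A : 'M[R]_n) (g : 'cV[R]_n)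
    (V : 'M[R]_(n, k + 1)) (Hb : 'M[R]_(k + 1, k)) : Prop := Arnoldi {
  arnoldi_start : lsubmx V *m e_first k = (norm2 g)^-1 *: g;
  arnoldi_orthonormal : (lsubmx V)^T *m lsubmx V = 1%:M;
  arnoldi_orthonormal_last : dsubmx Hb != 0 -> V^T *m V = 1%:M;
  arnoldi_hessenberg : forall (i : 'I_(k + 1)) (j : 'I_k),
    (j.+1 < i)%N -> Hb i j = 0;
  arnoldi_no_breakdown :
    forall (i : 'I_(k + 1)) (j : 'I_k),
    i = j.+1 :> nat -> (i < k)%N -> 0 < Hb i j;
  arnoldi_last_ge0 :
    forall (i : 'I_(k + 1)) (j : 'I_k),
    i = j.+1 :> nat -> i = k :> nat -> 0 <= Hb i j;
  arnoldi_relation : A *m lsubmx V = V *m Hb;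
  arnoldi_projection : usubmx Hb = (lsubmx V)^T *m A *m lsubmx V;
  arnoldi_krylov :
    ((lsubmx V)^T == \matrix_(i < k) (A ^+ i *m g)^T)%MS
}.

(* y_k(t) = V_k t phi(-t H_k) e_1, with V = V_k and H = H_k. *)
Definition krylov_approx n k (V : 'M[R]_(n, k)) (H : 'M[R]_k) (t : R) : 'cV[R]_n :=
  V *m (t *: mxfun phi (- t *: H)) *m e_first k.

(* Residual of y in the initial value problem y' = - A y + g, y(0) = 0. *)
Definition residual n (A : 'M[R]_n) (g : 'cV[R]_n) (y : R -> 'cV[R]_n) (t : R) :
    'cV[R]_n :=
  - A *m y t + g - derive1 y t.

End Defs.

Section PhiTaylor.
Variable R : realType.

(* Taylor coefficients at 0 of the m-th derivative of phi *)
Let c m i : R := (i`! * (i + m).+1)%:R^-1.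

Let c_diffs m : pseries_diffs (c m) = c m.+1.
Proof.
apply/funext => i; rewrite /pseries_diffs /c factS -mulnA natrM invfM mulrA.
by rewrite divff ?pnatr_eq0// mul1r addSnnS.
Qed.

Let c_cvg m z : cvgn (pseries (c m) z).
Proof.
apply: normed_cvg; apply: (series_le_cvg _ _ _ (@is_cvg_series_exp_coeff R `|z|)).
- by move=> i /=.
- by move=> i /=; exact: exp_coeff_ge0.
move=> i /=; rewrite /exp_coeff/= normrM normrX mulrC ler_wpM2l ?exprn_ge0//.
rewrite /c ger0_norm ?invr_ge0// lef_pV2 ?posrE ?ltr0n ?muln_gt0 ?fact_gt0//.
by rewrite ler_nat leq_pmulr.
Qed.

Let c_at0 m : limn (pseries (c m) 0) = m.+1%:R^-1.
Proof.
apply: lim_near_cst => //; near=> N.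
have N0 : (0 < N)%N by near: N; exact: nbhs_infty_gt.
rewrite /pseries /series /= -(prednK N0) big_nat_recl//= big1_seq ?addr0.
  by rewrite expr0 mulr1 /c fact0 mul1n add0n.
by move=> i _; rewrite exprS mul0r mulr0.
Unshelve. all: by end_near. Qed.

Let phiE z : phi z = limn (pseries (c 0) z).
Proof.
rewrite /phi; have [->|z0] := eqVneq z 0; first by rewrite c_at0 invr1.
rewrite -[RHS](mulfK z0); congr (_ / _); apply/esym.
have h : (pseries (c 0) z n * z) @[n --> \oo] --> limn (pseries (c 0) z) * z.
  by apply: cvgM; [exact: c_cvg|exact: cvg_cst].
rewrite -(cvg_lim _ h)//; apply: cvg_lim => //.
have e : (fun n => pseries (c 0) z n * z) = (fun n => series (exp_coeff z) n.+1 - 1).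
  apply/funext => n; rewrite /pseries /series/= big_nat_recl// /exp_coeff /= expr0 fact0 divr1.
  rewrite addrC addKr mulr_suml; apply: eq_bigr => i _.
  by rewrite /c addn0 mulnC -factS exprSr mulrAC mulrC mulrAC mulrA.
rewrite e; apply: cvgB; last exact: cvg_cst.
rewrite (_ : (fun _ => _) = (fun n => series (exp_coeff z) (n+1)%N)); last by apply/funext=> n; rewrite addn1.
by rewrite (cvg_shiftn 1 (series (exp_coeff z))); exact: is_cvg_series_exp_coeff.
Qed.

Let derive1n_phi m z : derive1n m (@phi R) z = limn (pseries (c m) z).
Proof.
elim: m z => [|m IH] z; first by rewrite derive1n0 phiE.
rewrite derive1nS derive1E -c_diffs.
rewrite (_ : derive1n m _ = fun x => limn (pseries (c m) x)); last exact/funext.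
have K : `|z| < `| `|z| + 1 | by rewrite [ltRHS]ger0_norm ?addr_ge0// ltrDl.
have := @pseries_snd_diffs _ (c m) (`|z| + 1) z (@c_cvg _ _).
rewrite !c_diffs => /(_ (@c_cvg _ _) (@c_cvg _ _) K) D.
exact: (@derive_val _ _ _ _ _ _ _ D).
Qed.

Lemma derive1n_phi0 m : derive1n m (@phi R) 0 = m.+1%:R^-1.
Proof. by rewrite derive1n_phi c_at0. Qed.

Lemma mxfun_phi k (M : 'M[R]_k) :
  mxfun (@phi R) M = limn (series (fun j => (j.+1)`!%:R^-1 *: M ^+ j)).
Proof.
rewrite /mxfun; congr (limn (series _)); apply/funext => j.
by rewrite derive1n_phi0 -invfM -natrM -factS.
Qed.

End PhiTaylor.

(* Main.v *)
Require Import Defs.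
From mathcomp Require Import all_boot all_order all_algebra.
From mathcomp Require Import all_classical all_reals all_analysis.
From mathcomp Require Import complex ring lra zify.
Set Implicit Arguments.
Unset Strict Implicit.
Unset Printing Implicit Defensive.
Import Order.TTheory GRing.Theory Num.Theory.
Import numFieldNormedType.Exports.
Local Open Scope classical_set_scope.
Local Open Scope ring_scope.

(** Write H for the projected matrix, h for its subdiagonal continuation and
    u(t) = t phi(-t H) e_1.  As u' = e_1 - H u, the Arnoldi relation collapses
    the residual to -h u_k(t) v_{k+1}, u_k being the last coordinate of u
    [residual_duhamel].  Since A - c has norm at most c on a spectrum in
    [0, 2c], so have its compressions, whence h <= c [last_entry_le], and it
    remains to bound c |u_k(t)|.

    With B = 1 - H / c, a symmetric contraction,
      c e^{ct} t phi(-t H) = sum_N (ct)^N / N! sum_(j < N) B^j,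
    because both sides solve the same linear differential equation
    [duhamel_shift].  Only the entries (k, 1) of the powers B^j matter.  On
    Chebyshev polynomials these are easy: T_j(B) has norm at most 1, and its
    entry (k, 1) vanishes for j < k - 1 as B is Hessenberg.  The powers of B
    are averages of these, B^j = E T_|S_j|(B), where S_j is the simple random
    walk on the integers: this is 2x T_z(x) = T_{z+1}(x) + T_{z-1}(x).  Hence
      |(B^j)_{k1}| <= P(|S_j| >= k - 1) <= 2 P(S_j >= k - 1)
    [norm_expr_le_walk].

    The weight a(z) = (z - k + 2)(z - k + 1), set to 0 for z < k, satisfies
    (a(z + 1) + a(z - 1)) / 2 - a(z) = 1 if z >= k - 1 and 0 otherwise, so the
    probabilities add up to an expectation: sum_(j < N) P(S_j >= k - 1) =
    E a(S_N) [norm_sum_le_walk_weight].  Finally sum_N x^N / N! E a(S_N), once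
    the law of S_N is written with binomial coefficients and sorted by the
    value nu of S_N, is sum_nu a(nu) I_nu(x) [poisson_walk_weight_le].
    Together these give the bound with the constant 2 in place of 4. *)

(** * Euclidean norms and symmetric matrices *)

Section EuclideanNorm.
Variable R : realType.

Definition sqnorm n (v : 'cV[R]_n) : R := \sum_i v i 0 ^+ 2.

Lemma sqnormE n (v : 'cV[R]_n) : (v^T *m v) 0 0 = sqnorm v.
Proof. by rewrite mxE; apply: eq_bigr => i _; rewrite mxE expr2. Qed.

Lemma sqnorm_ge0 n (v : 'cV[R]_n) : 0 <= sqnorm v.
Proof. by apply: sumr_ge0 => i _; exact: sqr_ge0. Qed.

Lemma sqnormZ n (a : R) (v : 'cV[R]_n) : sqnorm (a *: v) = a ^+ 2 * sqnorm v.
Proof.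
by rewrite mulr_sumr; apply: eq_bigr => i _; rewrite mxE exprMn.
Qed.

Lemma norm2E n (v : 'cV[R]_n) : norm2 v = Num.sqrt (sqnorm v).
Proof. by []. Qed.

Lemma sqr_coord_le n (v : 'cV[R]_n) i : v i 0 ^+ 2 <= sqnorm v.
Proof.
rewrite /sqnorm (bigD1 i)//= lerDl; apply: sumr_ge0 => j _; exact: sqr_ge0.
Qed.

Lemma sqnorm_isometry m n (V : 'M[R]_(n, m)) (v : 'cV[R]_m) :
  V^T *m V = 1%:M -> sqnorm (V *m v) = sqnorm v.
Proof.
by move=> VV; rewrite -!sqnormE trmx_mul mulmxA -[_ *m V^T *m V]mulmxA VV mulmx1.
Qed.

(** Expand |v - V V^T v|^2 >= 0, V V^T being an orthogonal projection. *)
Lemma sqnorm_coisometry_le m n (V : 'M[R]_(n, m)) (v : 'cV[R]_n) :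
  V^T *m V = 1%:M -> sqnorm (V^T *m v) <= sqnorm v.
Proof.
move=> VV; set u := V^T *m v.
have uE : V^T *m (V *m u) = u by rewrite mulmxA VV mul1mx.
have := sqnorm_ge0 (v - V *m u).
have tB : (v - V *m u)^T = v^T - (V *m u)^T by rewrite linearB.
rewrite -!sqnormE tB mulmxBl !mulmxBr.
rewrite [(V *m u)^T]trmx_mul -!mulmxA uE subrr subr0.
have -> : v^T *m (V *m u) = u^T *m u by rewrite mulmxA -[V]trmxK -trmx_mul.
by rewrite !mxE subr_ge0.
Qed.

End EuclideanNorm.

Section Spectral.
Local Open Scope sesquilinear_scope.
Variable R : realType.
Local Notation C := R[i].
Local Notation toC := (real_complex R).

(** The matrix is diagonalised by a unitary matrix over the complex numbers; its
    eigenvalues there are real, hence eigenvalues of the real matrix. *)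
Lemma symmetric_sqnorm_le n (M : 'M[R]_n) (c : R) (v : 'cV[R]_n) :
  M^T = M -> (forall a, eigenvalue M a -> `|a| <= c) ->
  sqnorm (M *m v) <= c ^+ 2 * sqnorm v.
Proof.
move=> Msym Meig.
pose MC := map_mx toC M; pose vC := map_mx toC v.
have Mreal : MC \is a mxOver Num.real.
  by apply/mxOverP => i j; rewrite mxE; apply/complex_realP; exists (M i j).
have Msymm : MC \is hermitianmx _ false idfun.
  apply/is_hermitianmxP; rewrite expr0 scale1r map_mx_id//.
  by rewrite map_trmx Msym.
have /orthomx_spectralP MCE := symmetric_normalmx Msymm Mreal.
have dreal := hermitian_spectral_diag_real (realsym_hermsym Msymm Mreal).
have Pu := spectral_unitarymx MC.
move: MCE dreal; rewrite (invmx_unitary Pu); move: Pu.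
set P := spectralmx MC; set d := spectral_diag MC => Pu MCE dreal.
have PP := unitarymxP Pu.
have PPd : P^t* *m P = 1%:M by apply: mulmx1C.
(* The i-th row of the unitary matrix P is a left eigenvector for d_i. *)
have dle i : `|d 0 i| <= toC c.
  have /mxOverP/(_ 0 i)/complex_realP[x dx] := dreal.
  have : eigenvalue MC (toC x).
    apply/eigenvalueP; exists (row i P).
      rewrite -row_mul MCE !mulmxA PP mul1mx -dx.
      by apply/rowP => j; rewrite mxE mul_diag_mx !mxE.
    apply/eqP => /rowP Pi0; have /matrixP/(_ i i) := PP.
    rewrite mxE big1 => [|j _].
      by rewrite mxE eqxx => /esym/eqP; rewrite oner_eq0.
    by have := Pi0 j; rewrite !mxE => ->; rewrite mul0r.
  rewrite eigenvalue_map => /Meig; rewrite dx -lecR.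
  by rewrite normc_def /= expr0n addr0 sqrtr_sqr.
have sqC (w : 'cV[R]_n) : toC (sqnorm w) = ((map_mx toC w)^t* *m map_mx toC w) 0 0.
  rewrite mxE rmorph_sum; apply: eq_bigr => i _; rewrite !mxE expr2 rmorphM.
  by congr (_ * _); apply/esym/CrealP/complex_realP; exists (w i 0).
have sqU (w : 'cV[C]_n) : (w^t* *m w) 0 0 = \sum_i `|w i 0| ^+ 2.
  by rewrite mxE; apply: eq_bigr => i _; rewrite !mxE mulrC normCK.
rewrite -lecR sqC rmorphM rmorphXn /= sqC -/vC map_mxM -/MC -/vC.
have -> : (vC^t* *m vC) = ((P *m vC)^t* *m (P *m vC)).
  by rewrite trmx_mul map_mxM !mulmxA -[_ *m P^t* *m P]mulmxA PPd mulmx1.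
have -> : ((MC *m vC)^t* *m (MC *m vC)) =
    ((diag_mx d *m (P *m vC))^t* *m (diag_mx d *m (P *m vC))).
  rewrite {1 2}MCE -!mulmxA [in LHS]trmx_mul map_mxM trmxCK -!mulmxA.
  by rewrite [P *m (P^t* *m _)]mulmxA PP mul1mx.
rewrite !sqU mulr_sumr; apply: ler_sum => i _; rewrite mul_diag_mx mxE.
rewrite normrM exprMn ler_wpM2r ?exprn_ge0// lerXn2r ?nnegrE//.
by rewrite (le_trans _ (dle i)).
Qed.
End Spectral.

(** * Functionals of the simple random walk *)

Section Walk.

(** 2^N times the expectation of f at the N-th position of the simple random walk
    started at 0: of the 2^N paths, C(N, i) make i steps down.  Not dividing
    by 2^N lets f take values in an arbitrary commutative monoid. *)
Definition walk (V : nmodType) N (f : int -> V) : V :=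
  \sum_(i < N.+1) f (N%:Z - (i.*2)%:Z) *+ 'C(N, i).

Lemma walk0 (V : nmodType) (f : int -> V) : walk 0 f = f 0.
Proof. by rewrite /walk big_ord1 subrr. Qed.

(** Conditioning on one step; a regrouping by Pascal's rule. *)
Lemma walkS (V : nmodType) N (f : int -> V) :
  walk N.+1 f = walk N (fun z => f (z + 1) + f (z - 1)).
Proof.
rewrite /walk; under [RHS]eq_bigr do rewrite mulrnDl.
rewrite big_split /= [in LHS]big_ord_recl /= bin0 mulr1n.
under [in LHS]eq_bigr => i _ do rewrite /bump /= add1n binS mulrnDr.
rewrite big_split /= addrA; congr (_ + _); last first.
  by apply: eq_bigr => i _; congr (f _ *+ _); lia.
rewrite [in RHS]big_ord_recl big_ord_recr /= bin_small// mulr0n !addr0 bin0.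
congr (_ + _); first by rewrite mulr1n; congr f; lia.
by apply: eq_bigr => i _; congr (f _ *+ _); rewrite /bump /=; lia.
Qed.

Lemma walkD (V : nmodType) N (f g : int -> V) :
  walk N (fun z => f z + g z) = walk N f + walk N g.
Proof. by rewrite -big_split; apply: eq_bigr => i _; rewrite mulrnDl. Qed.

Lemma walkMl (V : pzSemiRingType) (a : V) N (f : int -> V) :
  walk N (fun z => a * f z) = a * walk N f.
Proof. by rewrite mulr_sumr; apply: eq_bigr => i _; rewrite mulrnAr. Qed.

Lemma walk_opp (V : nmodType) N (f : int -> V) :
  walk N (fun z => f (- z)) = walk N f.
Proof.
rewrite /walk (reindex_inj rev_ord_inj); apply: eq_bigr => i _ /=.
rewrite -bin_sub; last lia.
by congr (f _ *+ 'C(_, _)); have := ltn_ord i; lia.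
Qed.

Lemma ler_walk (R : numDomainType) N (f g : int -> R) :
  (forall z, f z <= g z) -> walk N f <= walk N g.
Proof. by move=> fg; apply: ler_sum => i _; rewrite lerMn2r fg orbT. Qed.

Lemma ler_norm_walk (R : numDomainType) N (f : int -> R) :
  `|walk N f| <= walk N (fun z => `|f z|).
Proof.
apply: le_trans (ler_norm_sum _ _ _) _.
by apply: ler_sum => i _; rewrite normrMn.
Qed.

End Walk.

Section Weight.
Variable R : realType.

(** The coefficient of the Bessel function of order z in the final estimate. *)
Definition weight k (z : int) : R :=
  if k%:Z <= z then ((z - k%:Z + 2) * (z - k%:Z + 1))%:~R else 0.

(** The polynomial vanishes at k - 2 and k - 1, so the cut-off at k costs nothing
    from k - 2 on; this is what makes the second difference constant there. *)
Lemma weightE k (z : int) : k%:Z - 2 <= z ->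
  weight k z = ((z - k%:Z + 2) * (z - k%:Z + 1))%:~R.
Proof.
rewrite /weight; case: ifPn => // h1 h2.
have [->|->] : z = k%:Z - 2 \/ z = k%:Z - 1 by lia.
  by rewrite addrAC subrK subrr mul0r.
by rewrite [in X in _ * X]addrAC subrK subrr mulr0.
Qed.

(** Half the discrete Laplacian of the weight is the indicator of [k - 1, +oo[. *)
Lemma weight_step k (z : int) : (0 < k)%N ->
  weight k (z + 1) + weight k (z - 1)
    = weight k z *+ 2 + (k.-1%:Z <= z)%R%:R *+ 2.
Proof.
move=> k0; have [kz|kz] := lerP k.-1%:Z z.
  rewrite !weightE; try lia.
  rewrite /=; ring.
rewrite /weight !ifF ?mul0rn ?addr0//; apply/negbTE; lia.
Qed.

(** By [weight_step], W_N = walk N weight obeys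
    W_{N+1} = 2 W_N + 2 walk N (indicator of [k - 1, +oo[), and by symmetry the
    right-hand side of the hypothesis is at most twice that last walk. *)
Lemma norm_sum_le_walk_weight k (b : nat -> R) : (0 < k)%N ->
  (forall j, `|b j| *+ 2 ^ j <= walk j (fun z => (k.-1 <= `|z|)%N%:R)) ->
  forall N, `|\sum_(j < N) b j| *+ 2 ^ N <= walk N (weight k) *+ 2.
Proof.
move=> k0 bk; elim=> [|N IH].
  rewrite big_ord0 normr0 mul0rn walk0 mulrn_wge0// /weight ifF//.
  by apply/negbTE; lia.
rewrite big_ord_recr /= walkS.
have -> : (fun z => weight k (z + 1) + weight k (z - 1)) =
    fun z => weight k z *+ 2 + (k.-1%:Z <= z)%R%:R *+ 2.
  by apply/funext => z; exact: weight_step.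
have D f : walk N (fun z => f z *+ 2) = walk N f *+ 2 :> R.
  by rewrite mulr2n -walkD; congr walk; apply/funext => z; rewrite mulr2n.
rewrite walkD !D.
have bN : `|b N| *+ 2 ^ N <= walk N (fun z => (k.-1%:Z <= z)%R%:R) *+ 2.
  apply: le_trans (bk N) _; rewrite mulr2n -[X in _ <= X + _]walk_opp -walkD.
  apply: ler_walk => z /=; rewrite -natrD ler_nat.
  by case: leqP => //; lia.
apply: le_trans (_ : (`|\sum_(j < N) b j| + `|b N|) *+ 2 ^ N.+1 <= _).
  by rewrite lerMn2r ler_normD orbT.
rewrite expnS mulnC mulrnA -mulrnDl lerMn2r /= !mulrnDl.
exact: lerD.
Qed.

End Weight.

(** * Chebyshev polynomials of a Hessenberg contraction *)

Section Chebyshev.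
Variable R : comNzRingType.

(** The pairs (T_n, U_{n-1}) of Chebyshev polynomials of the first and second
    kind, computed by the addition formulas of the cosine and the sine: T_n and
    U_{n-1} are cos (n x) and sin (n x) / sin x as polynomials in cos x. *)
Fixpoint cheb n : {poly R} * {poly R} :=
  if n is m.+1 then
    ('X * (cheb m).1 - (1 - 'X^2) * (cheb m).2, 'X * (cheb m).2 + (cheb m).1)
  else (1, 0).

Definition chebT n := (cheb n).1.

Lemma cheb_pell n : (cheb n).1 ^+ 2 + (1 - 'X^2) * (cheb n).2 ^+ 2 = 1.
Proof. elim: n => [|n IH] /=; first by ring. rewrite -[RHS]IH; ring. Qed.

(** T is even in its index, so the three-term recurrence holds on all integers
    and T becomes an eigenfunction of the step of the random walk. *)
Lemma chebT_step (z : int) :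
  chebT (absz (z + 1)) + chebT (absz (z - 1)) = ('X * chebT `|z|) *+ 2.
Proof.
wlog z0 : z / 0 <= z => [h|].
  have [/h//|z0] := lerP 0 z.
  rewrite -[in RHS]abszN -h; last by rewrite oppr_ge0 ltW.
  have -> : - z + 1 = - (z - 1) by ring.
  by rewrite -opprD !abszN; exact: addrC.
case: z z0 => // -[|n] _.
  rewrite /chebT /=; ring.
have -> : absz (n.+1%:Z + 1) = n.+2 by lia.
have -> : absz (n.+1%:Z - 1) = n by lia.
rewrite /chebT /=; ring.
Qed.

Lemma walk_chebT N : walk N (fun z => chebT `|z|) = 'X^N *+ 2 ^ N.
Proof.
elim: N => [|N IH]; first by rewrite walk0.
rewrite walkS.
have -> : (fun z : int => chebT `|z + 1| + chebT `|z - 1|) =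
    (fun z => 'X *+ 2 * chebT `|z|).
  by apply/funext => z; rewrite chebT_step mulrnAl.
by rewrite walkMl IH exprS mulrnAl !mulrnAr expnS mulnC mulrnA.
Qed.

Lemma size_cheb n : (size (cheb n).1 <= n.+1)%N /\ (size (cheb n).2 <= n)%N.
Proof.
elim: n => [|n [IHt IHu]] /=; first by rewrite size_poly1 size_poly0.
have sX m (p : {poly R}) : (size p <= m)%N -> (size ('X * p)%R <= m.+1)%N.
  by move=> pm; rewrite (leq_trans (size_polyMleq _ _))// size_polyX.
split; rewrite (leq_trans (size_polyD _ _))// geq_max; last first.
  by rewrite IHt andbT sX.
rewrite sX//= size_polyN mulrBl mul1r (leq_trans (size_polyD _ _))// geq_max.
rewrite size_polyN expr2 -mulrA !sX ?andbT//.
by rewrite (leq_trans IHu)// -addn2 leq_addr.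
Qed.
End Chebyshev.

Section ChebyshevMatrix.
Variables (R : realType) (m : nat) (B : 'M[R]_m.+1).
Hypothesis Bsym : B^T = B.
Hypothesis Bcontr : forall w : 'cV[R]_m.+1, sqnorm (B *m w) <= sqnorm w.
Hypothesis Bhess : forall i j : 'I_m.+1, (j.+1 < i)%N -> B i j = 0.

Lemma horner_mx_sum (p : {poly R}) :
  horner_mx B p = \sum_(i < size p) p`_i *: B ^+ i.
Proof.
rewrite -{1}[p]coefK poly_def rmorph_sum; apply: eq_bigr => i _.
rewrite -mul_polyC rmorphM rmorphXn /= horner_mx_X horner_mx_C.
exact: mul_scalar_mx.
Qed.

Lemma tr_horner_mx_sym (p : {poly R}) : (horner_mx B p)^T = horner_mx B p.
Proof.
rewrite horner_mx_sum raddf_sum; apply: eq_bigr => i _ /=.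
rewrite linearZ /=; congr (_ *: _); elim: (nat_of_ord i) => [|j IH].
  by rewrite trmx1.
by rewrite {1}exprS trmx_mul IH Bsym exprSr.
Qed.

Lemma hessenberg_expr j (a : 'I_m.+1) : (j < a)%N -> (B ^+ j) a 0 = 0.
Proof.
elim: j a => [|j IH] a ja.
  by rewrite expr0 mxE; case: a ja => -[].
rewrite exprS mxE big1// => b _.
have [jb|bj] := ltnP j b; first by rewrite IH ?mulr0.
by rewrite Bhess ?mul0r// (leq_ltn_trans _ ja).
Qed.

Lemma hessenberg_horner (p : {poly R}) (a : 'I_m.+1) :
  (size p <= a)%N -> (horner_mx B p) a 0 = 0.
Proof.
move=> pa; rewrite horner_mx_sum summxE big1// => i _.
by rewrite mxE hessenberg_expr ?mulr0//; exact: leq_trans (ltn_ord i) pa.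
Qed.

(** By the Pell identity T_n^2 + (1 - x^2) U_{n-1}^2 = 1 taken at B,
    |T_n(B) e|^2 = |e|^2 - (|w|^2 - |B w|^2) with w = U_{n-1}(B) e, and the
    parenthesis is nonnegative because B is a contraction. *)
Lemma norm_chebT_mx_le n (a : 'I_m.+1) : `|horner_mx B (chebT R n) a 0| <= 1.
Proof.
pose e : 'cV[R]_m.+1 := delta_mx 0 0.
have -> : horner_mx B (chebT R n) a 0 = (horner_mx B (chebT R n) *m e) a 0.
  rewrite mxE (bigD1 0)//= big1 ?addr0 => [|j j0]; rewrite mxE ?eqxx ?mulr1//.
  by rewrite (negbTE j0) mulr0.
have e1 : sqnorm e = 1.
  rewrite /sqnorm (bigD1 0)//= big1 ?addr0 => [|j j0];
    rewrite mxE ?eqxx ?expr1n//.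
  by rewrite (negbTE j0) expr0n.
rewrite -(@expr_le1 _ 2)// real_normK ?num_real//.
apply: le_trans (sqr_coord_le _ _) _; rewrite -e1.
set T := horner_mx B _; set S := horner_mx B (cheb R n).2.
have pell : T *m T + (S *m S - (B *m S) *m (B *m S)) = 1%:M.
  have := congr1 (horner_mx B) (cheb_pell R n).
  rewrite rmorphD [X in _ + X]rmorphM rmorphB /= !rmorphXn rmorph1 /= horner_mx_X.
  rewrite -/S => pell; rewrite -[RHS]pell.
  rewrite mulrBl mul1r !expr2; congr (_ + (_ - _)).
  have BS : B *m S = S *m B.
    exact: comm_mx_horner.
  by rewrite -[RHS]/(B *m B *m (S *m S)) -!mulmxA [S *m (B *m S)]mulmxA -BS !mulmxA.
have q (X : 'M[R]_m.+1) : sqnorm (X *m e) = (e^T *m (X^T *m X) *m e) 0 0.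
  by rewrite -sqnormE trmx_mul !mulmxA.
have BSs : (B *m S)^T = B *m S.
  by rewrite trmx_mul Bsym tr_horner_mx_sym; apply/esym/comm_mx_horner.
have : sqnorm e = sqnorm (T *m e) + (sqnorm (S *m e) - sqnorm (B *m (S *m e))).
  rewrite mulmxA !q BSs !tr_horner_mx_sym -{1}[e]mul1mx q trmx1 mul1mx -pell.
  by rewrite mulmxDr mulmxBr mulmxDl mulmxBl !mxE.
have := Bcontr (S *m e); lra.
Qed.

(** B^N is the average of the T_|z|(B), and those with |z| < m have degree too
    small to reach the last row from the first. *)
Lemma norm_expr_le_walk N :
  `|(B ^+ N) ord_max 0| *+ 2 ^ N <= walk N (fun z => (m <= `|z|)%N%:R).
Proof.
have -> : `|(B ^+ N) ord_max 0| *+ 2 ^ N =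
    `|horner_mx B (walk N (fun z => chebT R `|z|)) ord_max 0|.
  rewrite walk_chebT raddfMn /= rmorphXn /= horner_mx_X.
  by rewrite -normrMn mulmxnE.
have -> : horner_mx B (walk N (fun z => chebT R `|z|)) ord_max 0 =
    walk N (fun z => horner_mx B (chebT R `|z|) ord_max 0).
  rewrite raddf_sum summxE; apply: eq_bigr => i _ /=.
  by rewrite raddfMn mulmxnE.
apply: le_trans (ler_norm_walk _ _) _; apply: ler_walk => z.
have [mz|zm] := leqP m `|z|; first exact: norm_chebT_mx_le.
by rewrite hessenberg_horner ?normr0// (leq_trans (size_cheb _ _).1).
Qed.
End ChebyshevMatrix.

(** * Exponential generating functions and linear differential equations *)

Section ExponentialGeneratingFunctions.
Variable R : realType.
Implicit Types (d : nat -> R) (t : R).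

Definition egf_coef d (N : nat) : R := d N / N`!%:R.

Definition egf d t : R := limn (pseries (egf_coef d) t).

(** Ensures that the exponential generating function is entire and may be
    differentiated term by term. *)
Definition geo_bounded d :=
  exists K L : R, [/\ 0 <= K, 0 <= L & forall N, `|d N| <= K * L ^+ N].

Lemma geo_boundedS d : geo_bounded d -> geo_bounded (fun N => d N.+1).
Proof.
move=> [K [L [K0 L0 dKL]]]; exists (K * L), L; split=> [||N]; rewrite ?mulr_ge0//.
by rewrite -mulrA -exprS.
Qed.

Lemma geo_bounded_expr (c : R) : geo_bounded (fun N => c ^+ N).
Proof. by exists 1, `|c|; split=> // N; rewrite normrX mul1r. Qed.

Lemma egf_cvg d t : geo_bounded d -> cvgn (pseries (egf_coef d) t).
Proof.
move=> [K [L [K0 L0 dKL]]]; apply: normed_cvg.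
apply: (@series_le_cvg _ _ (fun i => K * exp_coeff (L * `|t|) i)).
- by move=> i /=.
- by move=> i /=; rewrite mulr_ge0// exp_coeff_ge0// mulr_ge0.
- move=> i /=; rewrite /egf_coef /exp_coeff /= !normrM normfV normr_nat normrX.
  by rewrite exprMn !mulrA mulrAC !ler_wpM2r ?invr_ge0// exprn_ge0.
- by apply: is_cvg_seriesZ; exact: is_cvg_series_exp_coeff.
Qed.

Lemma egf0 d : egf d 0 = d 0.
Proof.
apply: lim_near_cst => //; near=> N.
have N0 : (0 < N)%N by near: N; exact: nbhs_infty_gt.
rewrite /pseries /series /= -(prednK N0) big_nat_recl//= big1_seq ?addr0.
  by rewrite expr0 mulr1 /egf_coef fact0 divr1.
by move=> i _; rewrite exprS mul0r mulr0.
Unshelve. all: by end_near. Qed.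

Lemma is_derive_egf d t : geo_bounded d ->
  is_derive t 1 (egf d) (egf (fun N => d N.+1) t).
Proof.
have diffs e : pseries_diffs (egf_coef e) = egf_coef (fun N => e N.+1).
  apply/funext => i; rewrite /pseries_diffs /egf_coef factS natrM invfM.
  by rewrite mulrCA mulVKf ?pnatr_eq0.
move=> db; rewrite /egf -diffs.
apply: (@pseries_snd_diffs _ _ (`|t| + 1)).
- exact: egf_cvg.
- by rewrite diffs; apply: egf_cvg; exact: geo_boundedS.
- by rewrite !diffs; apply: egf_cvg; exact: (geo_boundedS (geo_boundedS db)).
- by rewrite [ltRHS]ger0_norm ?addr_ge0// ltrDl.
Qed.

Lemma egf_expr c t : egf (fun N => c ^+ N) t = expR (c * t).
Proof.
rewrite /expR; congr (limn _); apply/funext => n; apply: eq_bigr => i _ /=.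
by rewrite /egf_coef /exp_coeff /= exprMn mulrAC.
Qed.

Lemma egf_linear a d e t : geo_bounded d -> geo_bounded e ->
  egf (fun N => a * d N + e N) t = a * egf d t + egf e t.
Proof.
move=> db eb; apply: cvg_lim => //.
rewrite (_ : pseries _ t =
    fun n => a * pseries (egf_coef d) t n + pseries (egf_coef e) t n).
  by apply: cvgD; [apply: cvgM; [exact: cvg_cst|exact: egf_cvg]|exact: egf_cvg].
apply/funext => n; rewrite /pseries /series /= mulr_sumr -big_split.
by apply: eq_bigr => i _ /=; rewrite /egf_coef !mulrDl !mulrA.
Qed.

Lemma geo_bounded_linear a d e : geo_bounded d -> geo_bounded e ->
  geo_bounded (fun N => a * d N + e N).
Proof.
move=> [K [L [K0 L0 dKL]]] [K' [L' [K0' L0' dKL']]].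
exists (`|a| * K + K'), (L + L'); split; rewrite ?addr_ge0 ?mulr_ge0// => N.
rewrite (le_trans (ler_normD _ _))// mulrDl lerD//.
  rewrite normrM -mulrA ler_wpM2l// (le_trans (dKL _))// ler_wpM2l//.
  by rewrite lerXn2r ?nnegrE ?addr_ge0// lerDl.
rewrite (le_trans (dKL' _))// ler_wpM2l//.
by rewrite lerXn2r ?nnegrE ?addr_ge0// lerDr.
Qed.

Lemma geo_bounded0 : geo_bounded (fun=> 0).
Proof. by exists 0, 0; split=> // N; rewrite normr0 mul0r. Qed.

Lemma egf_sum (I : Type) (r : seq I) (a : I -> R) (d : I -> nat -> R) t :
  (forall i, geo_bounded (d i)) ->
  geo_bounded (fun N => \sum_(i <- r) a i * d i N) /\
  egf (fun N => \sum_(i <- r) a i * d i N) t = \sum_(i <- r) a i * egf (d i) t.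
Proof.
move=> db; elim: r => [|i r [IHb IHe]].
  rewrite big_nil; under eq_fun do rewrite big_nil.
  split; first exact: geo_bounded0.
  apply: lim_near_cst => //; near=> N; rewrite /pseries /series /= big1// => j _.
  by rewrite /egf_coef !mul0r.
rewrite big_cons; under eq_fun do rewrite big_cons; split.
  exact: geo_bounded_linear.
by rewrite egf_linear// IHe.
Unshelve. all: by end_near. Qed.

End ExponentialGeneratingFunctions.

Section LinearODE.
Variables (R : realType) (m : nat) (M : 'M[R]_m).

Let K : R := \sum_i \sum_j `|M i j|.

Let K_ge0 : 0 <= K.
Proof. by apply: sumr_ge0 => i _; apply: sumr_ge0. Qed.

Lemma norm_mulmx_entry_le (x : 'cV[R]_m) (b : R) a :
  (forall i, `|x i 0| <= b) -> `|(M *m x) a 0| <= K * b.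
Proof.
move=> xb; rewrite mxE (le_trans (ler_norm_sum _ _ _))//.
have b0 : 0 <= b by exact: le_trans (xb a).
rewrite /K [X in _ <= X * _](bigD1 a)//= mulrDl -[leLHS]addr0 lerD//.
  by rewrite mulr_suml; apply: ler_sum => i _; rewrite normrM ler_wpM2l.
by rewrite mulr_ge0//; apply: sumr_ge0 => i _; apply: sumr_ge0.
Qed.

Lemma dot_mulmx_le (x : 'cV[R]_m) :
  \sum_a x a 0 * (M *m x) a 0 <= K * sqnorm x.
Proof.
rewrite /K mulr_suml; apply: ler_sum => a _; rewrite mxE mulr_sumr mulr_suml.
apply: ler_sum => b _; rewrite mulrCA.
apply: le_trans (ler_norm _) _; rewrite normrM ler_wpM2l//.
have := sqr_coord_le x a; have := sqr_coord_le x b.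
have := sqr_ge0 (`|x a 0| - `|x b 0|); rewrite normrM.
rewrite -[x a 0 ^+ 2]real_normK ?num_real//.
by rewrite -[x b 0 ^+ 2]real_normK ?num_real//; nra.
Qed.

(** Gronwall: t |-> e^{-2Kt} |w(t)|^2 is nonincreasing and starts at 0. *)
Lemma linear_ode_unique (w : R -> 'cV[R]_m) :
  (forall (t : R) a, is_derive t 1 (fun s => w s a 0) ((M *m w t) a 0)) ->
  w 0 = 0 -> forall t : R, 0 <= t -> w t = 0.
Proof.
move=> dw w0 t t0.
pose F (s : R) : R := expR (- (2 * K) * s) * sqnorm (w s).
pose dF (s : R) : R := expR (- (2 * K) * s) *
  (2 * \sum_a w s a 0 * (M *m w s) a 0 - 2 * K * sqnorm (w s)).
have FD (s : R) : is_derive s 1 F (dF s).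
  have DN : is_derive s 1 (fun s => sqnorm (w s))
      (\sum_a 2 * (w s a 0 * (M *m w s) a 0)).
    have : is_derive s 1 (\sum_(a < m) (fun s => w s a 0) ^+ 2)
        (\sum_(a < m) (2%:R * w s a 0 ^+ 1) *: (M *m w s) a 0).
      apply: is_derive_sum => a; exact: is_deriveX.
    rewrite (_ : \sum_(a < m) _ = fun s => sqnorm (w s)).
      move=> /is_derive_eq; apply; apply: eq_bigr => a _.
      by rewrite expr1 /GRing.scale /= mulrA.
    by apply/funext => u; rewrite fct_sumE.
  have DE : is_derive s 1 (fun s => expR (- (2 * K) * s))
      (expR (- (2 * K) * s) * (- (2 * K))).
    apply: (@is_derive1_comp _ expR (fun s => - (2 * K) * s)).
    have := @is_deriveZ R _ _ id (- (2 * K)) s 1 1 (is_derive_id _ _).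
    by rewrite /GRing.scale /= mulr1.
  apply: (is_derive_eq (is_deriveM DE DN)).
  rewrite /dF /GRing.scale /= -mulr_sumr; ring.
have dF0 s : dF s <= 0.
  rewrite /dF pmulr_rle0 ?expR_gt0// subr_le0 -mulrA ler_pM2l//.
  exact: dot_mulmx_le.
have Fcont : {within `[0, t], continuous F}.
  apply: derivable_within_continuous => s _.
  exact: (@ex_derive _ _ _ _ _ _ _ (FD s)).
have Ft : F t <= F 0.
  apply: (@ler0_derive1_nincr _ F 0 t) => // s _.
  by rewrite derive1E (@derive_val _ _ _ _ _ _ _ (FD s)).
have wt : sqnorm (w t) = 0.
  apply/eqP; rewrite eq_le sqnorm_ge0 andbT.
  move: Ft; rewrite /F w0 [sqnorm 0]big1 ?mulr0 => [|i _].
    by rewrite pmulr_rle0 ?expR_gt0.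
  by rewrite mxE expr0n.
apply/colP => a; rewrite mxE; apply/eqP; rewrite -sqrf_eq0 eq_le sqr_ge0 andbT.
by rewrite -wt sqr_coord_le.
Qed.

End LinearODE.

Section Duhamel.
Variables (R : realType) (m : nat) (M : 'M[R]_m) (c : R) (e : 'cV[R]_m).

(** Derivatives at 0 of the solution of u' = e^{ct} e + M u, u(0) = 0, that is of
    the Duhamel integral of e^{(t-s)M} e^{cs} e over s in [0, t]. *)
Fixpoint duhamel_coef N : 'cV[R]_m :=
  if N is N'.+1 then c ^+ N' *: e + M *m duhamel_coef N' else 0.

Definition duhamel t : 'cV[R]_m := \col_a egf (fun N => duhamel_coef N a 0) t.

Lemma duhamel_coefE N :
  duhamel_coef N = \sum_(j < N) c ^+ (N.-1 - j) *: (iter j (mulmx M) e).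
Proof.
elim: N => [|N IH] /=; first by rewrite big_ord0.
rewrite big_ord_recl subn0 /= IH linear_sum /=; congr (_ + _).
apply: eq_bigr => i _; rewrite -scalemxAr; congr (_ ^+ _ *: _).
by rewrite /bump /=; lia.
Qed.

Lemma duhamel_coef_bounded a : geo_bounded (fun N => duhamel_coef N a 0).
Proof.
pose K : R := \sum_i \sum_j `|M i j|; pose E : R := \sum_i `|e i 0|.
have K0 : 0 <= K by apply: sumr_ge0 => i _; apply: sumr_ge0.
have E0 : 0 <= E by apply: sumr_ge0.
pose L := `|c| + E + K; have L0 : 0 <= L by rewrite !addr_ge0.
exists 1, L; split=> // N; rewrite mul1r.
elim: N a => [|N IH] a; first by rewrite mxE normr0 expr0.
rewrite /= mxE (le_trans (ler_normD _ _))//.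
apply: le_trans (_ : L ^+ N * E + K * L ^+ N <= _); last first.
  rewrite exprSr /L !mulrDr [K * _]mulrC lerD2r lerDr mulr_ge0// exprn_ge0//.
rewrite lerD ?norm_mulmx_entry_le// mxE normrM normrX ler_pM// ?exprn_ge0//.
  by rewrite lerXn2r ?nnegrE// /L -addrA lerDl addr_ge0.
by rewrite /E (bigD1 a)//= lerDl sumr_ge0.
Qed.

Lemma duhamel0 : duhamel 0 = 0.
Proof. by apply/colP => a; rewrite !mxE egf0 mxE. Qed.

Lemma is_derive_duhamel (t : R) a :
  is_derive t 1 (fun s => duhamel s a 0)
    ((expR (c * t) *: e + M *m duhamel t) a 0).
Proof.
have -> : (fun s => duhamel s a 0) = egf (fun N => duhamel_coef N a 0).
  by apply/funext => s; rewrite mxE.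
apply: (is_derive_eq (is_derive_egf t (duhamel_coef_bounded a))).
have [b E] := egf_sum (index_enum 'I_m) (M a) t duhamel_coef_bounded.
rewrite 2!mxE -egf_expr [X in _ = _ + X]mxE.
under [X in _ = _ + X]eq_bigr do rewrite [duhamel _ _ _]mxE.
rewrite -E mulrC -egf_linear//; last exact: geo_bounded_expr.
by congr (egf _ t); apply/funext => N; rewrite /= !mxE mulrC.
Qed.

End Duhamel.

(** * Sums of modified Bessel functions *)

Section Bessel.
Variables (R : realType) (x : R).
Hypothesis x0 : 0 <= x.

Definition besselI_term nu m : R := (x / 2) ^+ (2 * m + nu) / (m`! * (m + nu)`!)%:R.

Lemma besselI_term_ge0 nu m : 0 <= besselI_term nu m.
Proof. by rewrite /besselI_term divr_ge0// exprn_ge0// divr_ge0. Qed.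

(** (m + nu)! >= nu! decouples m from nu; this majorant gives the convergence of
    each Bessel series and of the sum over the orders. *)
Lemma besselI_term_le nu m :
  besselI_term nu m <= exp_coeff (x / 2) nu * exp_coeff ((x / 2) ^+ 2) m.
Proof.
rewrite /besselI_term /exp_coeff /= exprD exprM.
rewrite mulrACA [_ ^+ nu * _]mulrC ler_wpM2l ?mulr_ge0 ?exprn_ge0 ?divr_ge0//.
rewrite -invfM lef_pV2 ?posrE -?natrM ?ltr0n ?muln_gt0 ?fact_gt0//.
by rewrite ler_nat mulnC leq_mul2l leq_fact ?orbT// leq_addl.
Qed.

Lemma besselI_cvg nu : cvgn (series (besselI_term nu)).
Proof.
apply: (@series_le_cvg _ _
  (fun m => exp_coeff (x / 2) nu * exp_coeff ((x / 2) ^+ 2) m)).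
- exact: besselI_term_ge0.
- by move=> m; rewrite mulr_ge0// exp_coeff_ge0 ?exprn_ge0 ?divr_ge0.
- exact: besselI_term_le.
- by apply: is_cvg_seriesZ; exact: is_cvg_series_exp_coeff.
Qed.

Lemma besselI_ge_sum nu n : \sum_(m < n) besselI_term nu m <= besselI nu x.
Proof.
have := nondecreasing_cvgn_le _ (@besselI_cvg nu) n.
rewrite /series /= big_mkord; apply; apply/nondecreasing_seqP => j.
by rewrite /series /= big_nat_recr//= lerDl besselI_term_ge0.
Qed.

Lemma besselI_ge0 nu : 0 <= besselI nu x.
Proof. by have := besselI_ge_sum nu 0; rewrite big_ord0. Qed.

Lemma besselI_le nu : besselI nu x <= exp_coeff (x / 2) nu * expR ((x / 2) ^+ 2).
Proof.
have -> : exp_coeff (x / 2) nu * expR ((x / 2) ^+ 2) =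
    limn (series (exp_coeff (x / 2) nu *: exp_coeff ((x / 2) ^+ 2))).
  by rewrite lim_seriesZ//; exact: is_cvg_series_exp_coeff.
apply: lim_series_le; first exact: besselI_cvg.
  by apply: is_cvg_seriesZ; exact: is_cvg_series_exp_coeff.
exact: besselI_term_le.
Qed.

Variable k : nat.
Let a nu : R := (nu - k + 2)%:R * (nu - k + 1)%:R.

Let a_le nu : a nu <= 8 * 2 ^+ nu.
Proof.
rewrite /a -natrM -natrX -natrM ler_nat.
apply: (@leq_trans ((nu + 2) * (nu + 1))).
  by apply: leq_mul; rewrite leq_add2r leq_subr.
elim: nu => // -[//|n] IH; rewrite expnS mulnCA.
apply: leq_trans (_ : 2 * ((n.+1 + 2) * (n.+1 + 1)) <= _)%N.
  by rewrite mulnCA [leqLHS]mulnC leq_mul//; lia.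
by rewrite leq_mul2l IH.
Qed.

(** The limit is meaningful because the terms are dominated by those of an
    exponential series: a(nu) <= 8 2^nu and I_nu(x) is at most
    (x/2)^nu / nu! times a constant. *)
Lemma weighted_besselI_ge_sum n :
  \sum_(k <= nu < n) a nu * besselI nu x <=
  \big[+%R/0]_(k <= nu <oo) (a nu * besselI nu x).
Proof.
have f0 nu : 0 <= a nu * besselI nu x by rewrite mulr_ge0 ?mulr_ge0// besselI_ge0.
have nd : nondecreasing_seq (fun n => \sum_(k <= nu < n) a nu * besselI nu x).
  apply/nondecreasing_seqP => j; have [jk|kj] := ltnP j k.
    by rewrite !big_geq// ltnW.
  by rewrite big_nat_recr//= lerDl.
apply: (nondecreasing_cvgn_le nd); apply: nondecreasing_is_cvgn => //.
pose E := expR ((x / 2) ^+ 2); have E0 : 0 <= E by exact: expR_ge0.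
exists (8 * E * expR x) => _ [j _ <-].
apply: (@le_trans _ _ (8 * E * \sum_(0 <= nu < j) exp_coeff x nu)); last first.
  rewrite ler_wpM2l ?mulr_ge0//.
  have := nondecreasing_cvgn_le _ (is_cvg_series_exp_coeff x) j; apply.
  apply/nondecreasing_seqP => i.
  by rewrite /series /= big_nat_recr//= lerDl exp_coeff_ge0.
have fle nu : a nu * besselI nu x <= 8 * E * exp_coeff x nu.
  apply: (@le_trans _ _ (8 * 2 ^+ nu * (exp_coeff (x / 2) nu * E))).
    by rewrite ler_pM ?besselI_ge0 ?besselI_le ?mulr_ge0.
  rewrite /exp_coeff /= expr_div_n.
  have : 2 ^+ nu != 0 :> R by rewrite expf_eq0 pnatr_eq0 andbF.
  move=> p; rewrite le_eqVlt; apply/orP; left; apply/eqP.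
  set f := (nu`!)%:R; have : f != 0 by rewrite pnatr_eq0 -lt0n fact_gt0.
  by move=> ?; field; apply/andP.
have g0 nu : 0 <= 8 * E * exp_coeff x nu by apply: le_trans (fle nu).
rewrite mulr_sumr; clearbody E; have [jk|kj] := ltnP j k.
  by rewrite [leLHS]big_geq; [exact: sumr_ge0|exact: ltnW].
rewrite [leRHS](big_cat_nat (leq0n k) kj) /= -[leLHS]add0r.
by apply: lerD; [exact: sumr_ge0|exact: ler_sum].
Qed.

(** A path of N steps, i of them down, ends at nu = N - 2i; its share of the
    Poisson sum is the i-th term of the series of I_nu, as
    C(N, i) / N! = 1 / (i! (i + nu)!). *)
Lemma weight_term N i : (k + 2 * i <= N)%N ->
  (x / 2) ^+ N / N`!%:R * (weight R k (N%:Z - (i.*2)%:Z) *+ 'C(N, i)) =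
  a (N - 2 * i)%N * besselI_term (N - 2 * i) i.
Proof.
move=> kN; have iN : (i <= N)%N by lia.
have -> : weight R k (N%:Z - (i.*2)%:Z) = a (N - 2 * i)%N.
  rewrite /weight ifT; last lia.
  rewrite /a -natrM [RHS]pmulrn PoszM; congr (_ *~ (_ * _)); lia.
rewrite /besselI_term (_ : 2 * i + (N - 2 * i) = N)%N; last lia.
rewrite (_ : i + (N - 2 * i) = N - i)%N; last lia.
rewrite -[_ *+ 'C(N, i)]mulr_natr mulrCA; congr (_ * _).
rewrite -mulrA; congr (_ * _).
rewrite -(bin_fact iN) natrM invfM mulrAC mulVf ?mul1r//.
by rewrite pnatr_eq0 -lt0n bin_gt0.
Qed.

(** Regrouping by the end point nu and the number i of down steps; the truncated
    sum becomes a sum over the pairs with nu + 2i < n, contained in a square. *)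
Lemma poisson_walk_weight_le n :
  \sum_(N < n) (x / 2) ^+ N / N`!%:R * walk N (weight R k) <=
  \big[+%R/0]_(k <= nu <oo) (a nu * besselI nu x).
Proof.
apply: le_trans (weighted_besselI_ge_sum n).
pose G nu i := a nu * besselI_term nu i.
have G0 nu i : 0 <= G nu i by rewrite mulr_ge0 ?besselI_term_ge0 ?mulr_ge0.
have -> : \sum_(N < n) (x / 2) ^+ N / N`!%:R * walk N (weight R k) =
    \sum_(0 <= i < n) \sum_(k + 2 * i <= N < n) G (N - 2 * i)%N i.
  rewrite -(big_mkord xpredT
    (fun N => (x / 2) ^+ N / N`!%:R * walk N (weight R k))).
  under [RHS]eq_bigr => i _ do rewrite (big_nat_widenl _ 0)// big_mkcond.
  rewrite exchange_big; apply: eq_big_nat => N /andP[_ Nn] /=.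
  rewrite -big_mkcond /= /walk mulr_sumr.
  rewrite -(big_mkord xpredT
    (fun i => _ / _ * (weight R k (N%:Z - (i.*2)%:Z) *+ 'C(N, i)))).
  rewrite (big_nat_widen _ _ n)//= [LHS]big_mkcond [RHS]big_mkcond.
  apply: eq_bigr => i _; rewrite ltnS.
  have [kN|Nk] := leqP (k + 2 * i) N; last first.
    case: ifP => // _; rewrite /weight ifF ?mul0rn ?mulr0//; apply/negbTE; lia.
  have -> : (i <= N)%N by lia.
  exact: weight_term.
apply: (@le_trans _ _ (\sum_(0 <= i < n) \sum_(k <= nu < n) G nu i)).
  apply: ler_sum => i _; rewrite big_addn.
  under eq_bigr do rewrite addnK.
  have [kn|nk] := leqP k (n - 2 * i).
    by rewrite [leRHS](big_cat_nat kn (leq_subr _ _)) /= lerDl sumr_ge0.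
  by rewrite big_geq ?sumr_ge0// ltnW.
rewrite exchange_big; apply: ler_sum => nu _ /=.
by rewrite -mulr_sumr ler_wpM2l ?mulr_ge0// big_mkord besselI_ge_sum.
Qed.
End Bessel.

(** * The function phi of a matrix *)

Section MatrixSeries.
Variable R : realType.

(** The convergence is uniform over the entries as they are finitely many. *)
Lemma cvg_mx_entries m n (F : nat -> 'M[R]_(m, n)) (L : 'M[R]_(m, n)) :
  (forall i j, F N i j @[N --> \oo] --> L i j) -> F N @[N --> \oo] --> L.
Proof.
move=> FL; apply/cvgrPdist_le => /= e e0.
near=> N; rewrite /Num.Def.normr/= mx_normrE (bigmax_le _ (ltW e0))//= => i _.
rewrite !mxE/=; move: i; near: N; apply: filter_forall => /= i.
exact: ((cvgrPdist_le _ _).1 (FL i.1 i.2)).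
Unshelve. all: by end_near. Qed.

Lemma expr_mx_iter m (M : 'M[R]_m) (v : 'cV[R]_m) j :
  M ^+ j *m v = iter j (mulmx M) v.
Proof.
elim: j => [|j IH]; first by rewrite expr0 mul1mx.
by rewrite iterS -IH exprS mulmxA.
Qed.

Lemma expr_scalemx m (a : R) (M : 'M[R]_m) j : (a *: M) ^+ j = a ^+ j *: M ^+ j.
Proof.
elim: j => [|j IH]; first by rewrite !expr0 scale1r.
by rewrite !exprS IH -[LHS]scalemxAl -scalemxAr scalerA.
Qed.

Lemma geo_bounded_mx_expr m (M : 'M[R]_m) a b : geo_bounded (fun j => (M ^+ j) a b).
Proof.
exists 1, (\sum_i \sum_j `|M i j|); split=> //.
  by apply: sumr_ge0 => i _; apply: sumr_ge0.
move=> N; rewrite mul1r; elim: N a => [|N IH] a.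
  by rewrite !expr0 mxE; case: eqP; rewrite ?normr1 ?normr0.
rewrite !exprS; have -> : (M * M ^+ N) a b = (M *m col b (M ^+ N)) a 0.
  by rewrite !mxE; apply: eq_bigr => j _; rewrite mxE.
by apply: norm_mulmx_entry_le => i; rewrite mxE.
Qed.

(** t phi(-t H) e is the integral of e^{-(t-s)H} e over s in [0, t], i.e. the case
    c = 0, where the Duhamel coefficients are the powers of -H applied to e. *)
Lemma mxfun_phi_duhamel m (H : 'M[R]_m) (t : R) :
  (t *: mxfun (@phi R) (- t *: H)) *m e_first R m =
  duhamel (- H) 0 (e_first R m) t.
Proof.
pose d a b j := ((- t *: H) ^+ j) a b / j.+1%:R.
have db a b : geo_bounded (d a b).
  have [K [L [K0 L0 dKL]]] := geo_bounded_mx_expr (- t *: H) a b.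
  exists K, L; split=> // N; rewrite /d normrM normfV normr_nat.
  by rewrite (le_trans _ (dKL N))// ler_piMr// invf_le1 ?ltr0n// ler1n.
have -> : mxfun (@phi R) (- t *: H) = \matrix_(a, b) egf (d a b) 1.
  rewrite mxfun_phi; apply: cvg_lim => //; apply: cvg_mx_entries => a b.
  rewrite mxE (_ : (fun N => _) = pseries (egf_coef (d a b)) 1).
    exact: egf_cvg.
  apply/funext => N; rewrite /pseries /series /= summxE; apply: eq_bigr => j _.
  by rewrite mxE expr1n mulr1 /egf_coef /d factS natrM invfM [LHS]mulrC mulrA.
apply/colP => a; rewrite -scalemxAl mxE mxE [RHS]mxE.
have := egf_sum (index_enum 'I_m) (fun b => e_first R m b 0) 1 (db a).
move=> [sb sE].
have -> : \sum_j (\matrix_(a0, b) egf (d a0 b) 1) a j * e_first R m j 0 =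
   egf (fun N => \sum_i e_first R m i 0 * d a i N) 1.
  by rewrite sE; apply: eq_bigr => b _; rewrite mxE mulrC.
apply/esym/cvg_lim => //; rewrite -(cvg_shiftn 1).
rewrite (_ : (fun N => _) = fun N =>
  t * pseries (egf_coef (fun N => \sum_i e_first R m i 0 * d a i N)) 1 N).
  by apply: cvgM; [exact: cvg_cst|exact: egf_cvg].
apply/funext => N; rewrite addn1 /pseries /series /= big_nat_recl//.
rewrite /egf_coef mxE !mul0r add0r mulr_sumr; apply: eq_bigr => j _.
rewrite expr1n mulr1.
have -> : duhamel_coef (- H) 0 (e_first R m) j.+1 = (- H) ^+ j *m e_first R m.
  rewrite duhamel_coefE big_ord_recr /= subnn expr0 scale1r.
  rewrite big1 ?add0r ?expr_mx_iter// => i _.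
  rewrite (_ : (j - i)%N = (j - i).-1.+1) ?expr0n ?scale0r//.
  by have := ltn_ord i; lia.
rewrite mxE -mulrA [RHS]mulrA !mulr_suml mulr_sumr mulr_suml; apply: eq_bigr => b _.
rewrite /d scaleNr -scalerN expr_scalemx mxE factS natrM invfM exprS.
rewrite [X in _ * (_ * (X / _))]mxE.
by set A := fun_of_matrix _ _ _; move: (j.+1%:R^-1) (j`!%:R^-1) => p q; ring.
Qed.

(** Both sides solve w' = e^{ct} e + (c - H) w, w(0) = 0.  The point of the factor
    e^{ct} is to trade the powers of -H, with alternating signs and large
    cancellations, for those of c - H, which has norm at most c when the
    spectrum of H lies in [0, 2c]. *)
Lemma duhamel_shift m (H : 'M[R]_m) (c : R) (e : 'cV[R]_m) (t : R) : 0 <= t ->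
  expR (c * t) *: duhamel (- H) 0 e t = duhamel (c%:M - H) c e t.
Proof.
move=> t0; apply/eqP; rewrite -subr_eq0; apply/eqP.
apply: (@linear_ode_unique _ _ (c%:M - H)
  (fun t => expR (c * t) *: duhamel (- H) 0 e t - duhamel (c%:M - H) c e t)) => //.
  move=> s a.
  have DE : is_derive s 1 (fun s => expR (c * s)) (expR (c * s) * c).
    apply: (@is_derive1_comp _ expR (fun s => c * s)).
    have := @is_deriveZ R _ _ id c s 1 1 (is_derive_id _ _).
    by rewrite /GRing.scale /= mulr1.
  have D1 := is_derive_duhamel (- H) 0 e s a.
  have D2 := is_derive_duhamel (c%:M - H) c e s a.
  have := is_deriveB (is_deriveM DE D1) D2.
  rewrite [X in is_derive _ _ X _](_ : _ = fun s =>
    (expR (c * s) *: duhamel (- H) 0 e s - duhamel (c%:M - H) c e s) a 0);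
      last first.
    apply/funext => u.
    by rewrite [RHS]mxE [X in _ = X + _]mxE [X in _ = _ + X]mxE.
  move/is_derive_eq; apply.
  rewrite mul0r expR0 scale1r.
  move: (duhamel _ _ _ _) (duhamel _ _ _ _) (expR _) => u1 u2 E.
  rewrite mulmxBr !mulmxBl !mul_scalar_mx -!scalemxAr !mulNmx.
  move: (H *m u1) (H *m u2) => p q.
  by rewrite /GRing.scale /= !mxE; ring.
by rewrite !duhamel0 scaler0 subr0.
Qed.

Lemma derive1_mulmx_duhamel n m (V : 'M[R]_(n, m)) (M : 'M[R]_m) (c t : R)
    (e : 'cV[R]_m) :
  derive1 (fun s => V *m duhamel M c e s) t
  = V *m (expR (c * t) *: e + M *m duhamel M c e t).
Proof.
have D i j : is_derive t 1 (fun s => (V *m duhamel M c e s) i j)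
    ((V *m (expR (c * t) *: e + M *m duhamel M c e t)) i j).
  rewrite (ord1 j) [X in is_derive _ _ _ X]mxE.
  have : is_derive t 1 (\sum_(a < m) (V i a \*: (fun s => duhamel M c e s a 0)))
      (\sum_(a < m) V i a *: (expR (c * t) *: e + M *m duhamel M c e t) a 0).
    by apply: is_derive_sum => a; apply: is_deriveZ; exact: is_derive_duhamel.
  rewrite [X in is_derive _ _ X _](_ : _ = fun s => (V *m duhamel M c e s) i 0)//.
  by apply/funext => s; rewrite fct_sumE mxE.
rewrite derive1E derive_mx; last first.
  apply/derivable_mxP => i j; exact: (@ex_derive _ _ _ _ _ _ _ (D i j)).
by apply/matrixP => i j; rewrite mxE (@derive_val _ _ _ _ _ _ _ (D i j)).
Qed.

End MatrixSeries.

(** * The last coordinate of t phi(-t H) e_1 *)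

Section CoefficientBound.
Variables (R : realType) (m : nat) (H : 'M[R]_m.+1) (c : R).
Hypothesis c0 : 0 < c.
Hypothesis Hsym : H^T = H.
Hypothesis Hhess : forall i j : 'I_m.+1, (j.+1 < i)%N -> H i j = 0.
Hypothesis Hcontr : forall w : 'cV[R]_m.+1,
  sqnorm ((H - c%:M) *m w) <= c ^+ 2 * sqnorm w.

Let B : 'M[R]_m.+1 := 1 - c^-1 *: H.

Let BE : B = - (c^-1 *: (H - c%:M)).
Proof. by rewrite scalerBr scale_scalar_mx mulVf ?gt_eqF// opprB. Qed.

Let cB : c%:M - H = c *: B.
Proof. by rewrite BE scalerN scalerA mulfV ?gt_eqF// scale1r opprB. Qed.

(** The N-th coefficient is c^(N-1) times the sum of the B^j e_1 with j < N, where
    c - H = c B. *)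
Lemma duhamel_coef_last_le N :
  `|c * duhamel_coef (c%:M - H) c (e_first R m.+1) N ord_max 0|
    <= (c / 2) ^+ N * (walk N (weight R m.+1) *+ 2).
Proof.
have Bsym : B^T = B by rewrite /B linearB linearZ /= Hsym trmx1.
have Bhess (i j : 'I_m.+1) : (j.+1 < i)%N -> B i j = 0.
  move=> ji; rewrite !mxE Hhess// mulr0 subr0.
  by case: eqP ji => // ->; rewrite ltnNge leqnSn.
have Bcontr (w : 'cV[R]_m.+1) : sqnorm (B *m w) <= sqnorm w.
  rewrite BE -scaleNr -scalemxAl sqnormZ sqrrN exprVn.
  by rewrite ler_pdivrMl ?exprn_gt0.
have -> : c * duhamel_coef (c%:M - H) c (e_first R m.+1) N ord_max 0 =
    c ^+ N * \sum_(j < N) (B ^+ j) ord_max 0.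
  rewrite duhamel_coefE summxE !mulr_sumr; apply: eq_bigr => j _.
  rewrite mxE -expr_mx_iter cB expr_scalemx -scalemxAl mxE.
  have -> : (B ^+ j *m e_first R m.+1) ord_max 0 = (B ^+ j) ord_max 0.
    rewrite mxE (bigD1 0)//= big1 ?addr0 => [|b b0]; first by rewrite mxE mulr1.
    by rewrite mxE -[nat_of_ord b == 0%N]/(b == 0) (negbTE b0) mulr0.
  rewrite !mulrA -exprS -exprD; congr (_ ^+ _ * _); have := ltn_ord j; lia.
rewrite normrM ger0_norm ?exprn_ge0 ?(ltW c0)// expr_div_n -mulrA.
rewrite ler_wpM2l ?exprn_ge0 ?(ltW c0)// mulrC ler_pdivlMr ?exprn_gt0//.
rewrite -natrX mulr_natr.
apply: (@norm_sum_le_walk_weight R m.+1 (fun j => (B ^+ j) ord_max 0)) => // j.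
exact: norm_expr_le_walk.
Qed.

(** Termwise estimate of the exponential generating function of the coefficients
    bounded in [duhamel_coef_last_le], on every partial sum. *)
Lemma norm_duhamel_last_le (t : R) : 0 <= t ->
  `|c * duhamel (- H) 0 (e_first R m.+1) t ord_max 0| <=
  expR (- (c * t)) * (2 * \big[+%R/0]_(m.+1 <= nu <oo)
    ((nu - m.+1 + 2)%:R * (nu - m.+1 + 1)%:R * besselI nu (c * t))).
Proof.
move=> t0; set S := \big[_/_]_(_ <= nu <oo) _.
rewrite expRN [leRHS]mulrC ler_pdivlMr ?expR_gt0//.
rewrite -[X in _ * X](ger0_norm (expR_ge0 (c * t))) -normrM.
have -> : c * duhamel (- H) 0 (e_first R m.+1) t ord_max 0 * expR (c * t) =
    c * duhamel (c%:M - H) c (e_first R m.+1) t ord_max 0.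
  by rewrite -duhamel_shift// [in RHS]mxE -mulrA [_ * expR _]mulrC.
rewrite [duhamel _ _ _ _ _ _]mxE.
set d := fun N => _.
have db : geo_bounded d by exact: duhamel_coef_bounded.
have cv : (fun n => `|c * pseries (egf_coef d) t n|) @ \oo --> `|c * egf d t|.
  by apply: cvg_norm; apply: cvgM; [exact: cvg_cst|exact: egf_cvg].
rewrite -(cvg_lim _ cv)//; apply: limr_le.
  by apply/cvg_ex; eexists; exact: cv.
apply: nearW => n.
rewrite /pseries /series /= big_mkord mulr_sumr.
apply: le_trans (ler_norm_sum _ _ _) _.
apply: (@le_trans _ _ (2 * \sum_(N < n)
    (c * t / 2) ^+ N / N`!%:R * walk N (weight R m.+1))); last first.
  rewrite ler_pM2l//; apply: poisson_walk_weight_le.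
  exact: mulr_ge0 (ltW c0) t0.
rewrite mulr_sumr; apply: ler_sum => N _.
rewrite /egf_coef !mulrA normrM normrM normfV normr_nat normrX (ger0_norm t0).
have := duhamel_coef_last_le N; rewrite -/(d N) => dN.
have -> : 2 * (c * t / 2) ^+ N / N`!%:R * walk N (weight R m.+1) =
    (c / 2) ^+ N * (walk N (weight R m.+1) *+ 2) / N`!%:R * t ^+ N.
  rewrite [c * t / 2]mulrAC exprMn; move: N`!%:R^-1 (walk _ _) => f w; ring.
by rewrite !ler_wpM2r ?invr_ge0 ?exprn_ge0.
Qed.

End CoefficientBound.

(** * The Arnoldi residual *)

Section Arnoldi.
Variable R : realType.

Lemma arnoldi_symmetric n m (A : 'M[R]_n) (V : 'M[R]_(n, m)) :
  A^T = A -> (V^T *m A *m V)^T = V^T *m A *m V.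
Proof. by move=> As; rewrite !trmx_mul trmxK As mulmxA. Qed.

Lemma arnoldi_contraction n m (A : 'M[R]_n) (V : 'M[R]_(n, m)) (c : R) :
  (forall v : 'cV[R]_n, sqnorm ((A - c%:M) *m v) <= c ^+ 2 * sqnorm v) ->
  V^T *m V = 1%:M ->
  forall w : 'cV[R]_m, sqnorm ((V^T *m A *m V - c%:M) *m w) <= c ^+ 2 * sqnorm w.
Proof.
move=> Ac VV w.
have -> : V^T *m A *m V - c%:M = V^T *m ((A - c%:M) *m V).
  by rewrite mulmxBl mulmxBr mulmxA mul_scalar_mx -scalemxAr VV scalemx1.
rewrite -!mulmxA; apply: le_trans (sqnorm_coisometry_le _ VV) _.
by rewrite (le_trans (Ac _))// sqnorm_isometry.
Qed.

(** In -A y + g - y' the parts inside the Krylov space cancel, because u solves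
    u' = e_1 - H u; what remains is the defect of the Arnoldi relation. *)
Lemma residual_duhamel n k (A : 'M[R]_n) (g : 'cV[R]_n)
    (V : 'M[R]_(n, k + 1)) (Hb : 'M[R]_(k + 1, k)) (t : R) :
  lsubmx V *m e_first R k = g -> A *m lsubmx V = V *m Hb ->
  residual A g (krylov_approx (lsubmx V) (usubmx Hb)) t =
  - (rsubmx V *m (dsubmx Hb *m duhamel (- usubmx Hb) 0 (e_first R k) t)).
Proof.
move=> Ve AV.
have yE : krylov_approx (lsubmx V) (usubmx Hb) =
    fun s => lsubmx V *m duhamel (- usubmx Hb) 0 (e_first R k) s.
  by apply/funext => s; rewrite /krylov_approx -mulmxA mxfun_phi_duhamel.
rewrite /residual yE derive1_mulmx_duhamel mul0r expR0 scale1r mulmxDr Ve.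
set u := duhamel _ _ _ _.
have -> : - A *m (lsubmx V *m u) =
    - (lsubmx V *m (usubmx Hb *m u)) - rsubmx V *m (dsubmx Hb *m u).
  rewrite mulNmx [in LHS]mulmxA AV -{1}[V]hsubmxK -{1}[Hb]vsubmxK mul_row_col.
  by rewrite mulmxDl !mulmxA opprD.
rewrite mulNmx mulmxN; move: (lsubmx V *m _) (rsubmx V *m _) => p q.
by apply/matrixP => i j; rewrite !mxE; ring.
Qed.

Lemma sqnorm_rsubmx n k (V : 'M[R]_(n, k + 1)) (x : 'cV[R]_1) :
  V^T *m V = 1%:M -> sqnorm (rsubmx V *m x) = x 0 0 ^+ 2.
Proof.
move=> VV; have -> : rsubmx V *m x = V *m col_mx 0 x.
  by rewrite -[in RHS](hsubmxK V) mul_row_col mulmx0 add0r.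
rewrite sqnorm_isometry// /sqnorm big_split_ord /= big1 => [|i _].
  by rewrite add0r big_ord1 col_mxEd.
by rewrite col_mxEu mxE expr0n.
Qed.

(** The entry is the last coordinate, in the orthonormal columns of V, of
    (A - c) applied to the last Krylov vector. *)
Lemma last_entry_le n m (A : 'M[R]_n) (V : 'M[R]_(n, m.+1 + 1))
    (Hb : 'M[R]_(m.+1 + 1, m.+1)) (c : R) :
  (forall v : 'cV[R]_n, sqnorm ((A - c%:M) *m v) <= c ^+ 2 * sqnorm v) ->
  V^T *m V = 1%:M -> (lsubmx V)^T *m lsubmx V = 1%:M ->
  A *m lsubmx V = V *m Hb ->
  dsubmx Hb 0 ord_max ^+ 2 <= c ^+ 2.
Proof.
move=> Ac VV lVV AV; pose e : 'cV[R]_m.+1 := delta_mx ord_max 0.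
have e1 : sqnorm e = 1.
  rewrite /sqnorm (bigD1 ord_max)//= big1 ?addr0 => [|j j0];
    rewrite mxE ?eqxx ?expr1n//.
  by rewrite (negbTE j0) expr0n.
have := Ac (lsubmx V *m e); rewrite (sqnorm_isometry e lVV) e1 mulr1.
apply: le_trans.
have -> : (A - c%:M) *m (lsubmx V *m e) = V *m (Hb *m e - col_mx (c *: e) 0).
  rewrite mulmxBl mulmxBr !mulmxA AV mul_scalar_mx; congr (_ - _).
  by rewrite -[in RHS](hsubmxK V) mul_row_col mulmx0 addr0 -scalemxAl scalemxAr.
rewrite sqnorm_isometry//; apply: le_trans (sqr_coord_le _ (rshift _ 0)).
suff -> : (Hb *m e - col_mx (c *: e) 0) (rshift m.+1 0) 0 =
  dsubmx Hb 0 ord_max by [].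
rewrite [LHS]mxE -colE mxE -{1}[Hb]vsubmxK col_mxEd.
by rewrite [X in _ + X]mxE col_mxEd [X in _ - X]mxE subr0.
Qed.

End Arnoldi.

Theorem proposition4p3 (R : realType) (n k : nat) (A : 'M[R]_n) (c : R)
    (g : 'cV[R]_n) (V : 'M[R]_(n, k + 1)) (Hb : 'M[R]_(k + 1, k)) (t : R) :
  A^T = A ->
  0 < c ->
  (forall a : R, eigenvalue A a -> 0 <= a <= 2 * c) ->
  norm2 g = 1 ->
  0 <= t ->
  (2 <= k)%N ->
  arnoldi A g V Hb ->
  norm2 (residual A g (krylov_approx (lsubmx V) (usubmx Hb)) t)
    <= 4 * expR (- (c * t)) *
       \big[+%R/0]_(k <= nu <oo)
         ((nu - k + 2)%:R * (nu - k + 1)%:R * besselI nu (c * t)).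
Proof.
case: k V Hb => [|m] V Hb// Asym c0 Aeig g1 t0 _ [Ve VV1 VV Hhess _ _ AV Hproj _].
have Ac (v : 'cV[R]_n) : sqnorm ((A - c%:M) *m v) <= c ^+ 2 * sqnorm v.
  apply: symmetric_sqnorm_le => [|a]; first by rewrite linearB /= Asym tr_scalar_mx.
  move=> /eigenvalueP[u uA u0]; rewrite ler_norml.
  have /Aeig : eigenvalue A (a + c).
    apply/eigenvalueP; exists u => //.
    by rewrite scalerDl -uA mulmxBr mul_mx_scalar subrK.
  by move=> /andP[]; lra.
have Hsym : (usubmx Hb)^T = usubmx Hb by rewrite Hproj arnoldi_symmetric.
have Hh (i j : 'I_m.+1) : (j.+1 < i)%N -> usubmx Hb i j = 0.
  by move=> ji; rewrite mxE Hhess.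
have Hc (w : 'cV[R]_m.+1) :
    sqnorm ((usubmx Hb - c%:M) *m w) <= c ^+ 2 * sqnorm w.
  by rewrite Hproj; apply: arnoldi_contraction.
have uB := norm_duhamel_last_le c0 Hsym Hh Hc t0.
have Ve' : lsubmx V *m e_first R m.+1 = g by rewrite Ve g1 invr1 scale1r.
rewrite (residual_duhamel t Ve' AV) norm2E -scaleN1r sqnormZ sqrrN expr1n mul1r.
set u := duhamel _ _ _ _ in uB *; set S := \big[_/_]_(_ <= nu <oo) _ in uB *.
have S0 : 0 <= expR (- (c * t)) * (2 * S) by apply: le_trans uB.
apply: (@le_trans _ _ (expR (- (c * t)) * (2 * S))); last by nra.
(* If h = 0 the last column of V is arbitrary, but its coefficient vanishes. *)
have [D0|D0] := eqVneq (dsubmx Hb) 0.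
  by rewrite D0 mul0mx mulmx0 [sqnorm 0]big1 ?sqrtr0// => i _; rewrite mxE expr0n.
have VV' := VV D0.
rewrite sqnorm_rsubmx// sqrtr_sqr; apply: le_trans uB.
rewrite mxE (bigD1 ord_max)//= big1 ?addr0 => [|j jm].
  rewrite !normrM ler_wpM2r// -ler_sqr ?nnegrE// !real_normK ?num_real//.
  exact: last_entry_le Ac VV' VV1 AV.
rewrite mxE Hhess ?mul0r//=.
have := ltn_ord j; move: jm; rewrite -val_eqE /=; lia.
Qed.
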